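(* The map-multiplicity $m_{\rm map}$ is a multiplicity on the category of non-empty sets and maps. Namely: (1) $m_{\rm map}(\mathrm{id}_X)=1$ for any non-empty set $X$. (2) For any maps $f:X\to Y$ and $g:Y\to Z$ between non-empty sets, $m_{\rm map}(g\circ f)\leq m_{\rm map}(f)\,m_{\rm map}(g)$.
   Context: For a set $A$, $|A|$ denotes its cardinality, where $|A|=\infty$ for every infinite set $A$ (all infinite cardinalities are denoted by the same symbol $\infty$). For a map $f:X\to Y$ of non-empty sets, its map-multiplicity is $m_{\rm map}(f)=\sup\{|f^{-1}(y)|\mid y\in Y\}\in\mathbb{N}\cup\{\infty\}$. Multiplication is extended to $\mathbb{R}\cup\{\infty\}$ by $r\cdot\infty=\infty\cdot r=\infty\cdot\infty=\infty$ for positive real $r$, and $r\le\infty$ for all $r$. A multiplicity $m$ on a category assigns to each morphism $f:X\to Y$ an element $m(f)\in\mathbb{R}_{\geq 1}\cup\{\infty\}$ such that $m(\mathrm{id}_X)=1$ for every object $X$, and $m(g\circ f)\leq m(f)m(g)$ for all composable morphisms. *)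

(* Defs.v *)
From mathcomp Require Import all_boot all_order all_algebra.
From mathcomp Require Import all_classical all_reals.
From mathcomp Require Import ereal counting_measure.

Set Implicit Arguments.
Unset Strict Implicit.
Unset Printing Implicit Defensive.

Local Open Scope classical_set_scope.
Local Open Scope ereal_scope.

Record category := Category {
  obj : Type;
  hom : obj -> obj -> Type;
  idm : forall X, hom X X;
  compm : forall X Y Z, hom Y Z -> hom X Y -> hom X Z;
  compm1 : forall X Y (f : hom X Y), compm f (idm X) = f;
  comp1m : forall X Y (f : hom X Y), compm (idm Y) f = f;
  compmA : forall X Y Z W (h : hom Z W) (g : hom Y Z) (f : hom X Y),
    compm h (compm g f) = compm (compm h g) f }.

Arguments hom {c}.
Arguments idm {c}.
Arguments compm {c X Y Z}.

(* [mult_ge1] says that the values lie in R_{>=1} together with +oo: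
   it excludes -oo. *)
Record is_multiplicity (R : realType) (C : category)
    (m : forall X Y : obj C, hom X Y -> \bar R) : Prop := IsMultiplicity {
  mult_ge1 : forall (X Y : obj C) (f : hom X Y), 1 <= m X Y f;
  mult_id : forall X : obj C, m X X (idm X) = 1;
  mult_comp : forall (X Y Z : obj C) (f : hom X Y) (g : hom Y Z),
    m X Z (compm g f) <= m X Y f * m Y Z g }.

Record nonempty_set := NonemptySet {
  carrier :> Type;
  carrier_nonempty : inhabited carrier }.

Definition nonempty_sets : category :=
  @Category nonempty_set (fun X Y => X -> Y)
    (fun _ => id) (fun _ _ _ g f => g \o f)
    (fun _ _ _ => erefl) (fun _ _ _ => erefl) (fun _ _ _ _ _ _ _ => erefl).

(* [counting] is the number of elements of a finite set and +oo on every
   infinite set; it asks for a choiceType, which [{classic T}] provides on an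
   arbitrary type [T]. *)
Definition cardinality (R : realType) (T : Type) (A : set T) : \bar R :=
  @counting {classic T} R A.

Definition map_multiplicity (R : realType) (X Y : nonempty_set) (f : X -> Y) :
    \bar R :=
  ereal_sup [set cardinality R (f @^-1` [set y]) | y in [set: Y]].
Arguments map_multiplicity R {X Y} f.

(* Main.v *)
Require Import Defs.
From mathcomp Require Import all_boot all_order all_algebra.
From mathcomp Require Import all_classical all_reals.
From mathcomp Require Import finmap ereal counting_measure.

(** The fibre of [g \o f] over [z] is the preimage under [f] of the fibre
    [B] of [g] over [z], that is, the union of the fibres of [f] over the
    points of [B].  So it has at most [m(f) * #B <= m(f) * m(g)] elements
    ([cardinality_preimage]); when [B] is infinite, this bound is [+oo] because
    [m(f)] is positive.  The bound on the union uses only the subadditivity of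
    cardinality ([cardinalityU_le]), so fibres of [f] that are infinite need no
    separate treatment.

    Non-emptiness of the source gives [1 <= m(f)] ([map_multiplicity_ge1]): the
    fibre over the image of a point is not empty.  For an identity this is an
    equality, as its fibres are singletons. *)

Set Implicit Arguments.
Unset Strict Implicit.
Unset Printing Implicit Defensive.

Import Order.TTheory GRing.Theory Num.Theory.

Local Open Scope classical_set_scope.
Local Open Scope ereal_scope.

Section Cardinality.
Variable R : realType.

Lemma cardinality_finite (T : Type) (A : set T) : finite_set A ->
  cardinality R A = (#|` fset_set (A : set {classic T})|%fset)%:R%:E.
Proof. by move=> finA; rewrite /cardinality /counting asboolT. Qed.

Lemma cardinality_infinite (T : Type) (A : set T) : infinite_set A ->
  cardinality R A = +oo.
Proof. by move=> infA; rewrite /cardinality /counting asboolF. Qed.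

Lemma cardinality0 (T : Type) : cardinality R (@set0 T) = 0.
Proof. by rewrite cardinality_finite// fset_set0. Qed.

Lemma cardinality1 (T : Type) (x : T) : cardinality R [set x] = 1.
Proof. by rewrite cardinality_finite// fset_set1 cardfs1. Qed.

Lemma cardinality_ge0 (T : Type) (A : set T) : 0 <= cardinality R A.
Proof.
have [finA|infA] := pselect (finite_set A).
  by rewrite cardinality_finite// lee_fin.
by rewrite cardinality_infinite.
Qed.

Lemma cardinality_ge1 (T : Type) (A : set T) : A !=set0 ->
  1 <= cardinality R A.
Proof.
case=> x Ax; have [finA|infA] := pselect (finite_set A); last first.
  by rewrite cardinality_infinite// leey.
rewrite cardinality_finite// lee_fin ler1n cardfs_gt0.
by apply/fset0Pn; exists x; rewrite in_fset_set//; exact/mem_set.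
Qed.

Lemma cardinalityU_le (T : Type) (A B : set T) :
  cardinality R (A `|` B) <= cardinality R A + cardinality R B.
Proof.
have [finA|infA] := pselect (finite_set A); last first.
  rewrite [in leRHS](cardinality_infinite infA) addye ?leey//.
  by rewrite gt_eqF// (lt_le_trans _ (cardinality_ge0 B)).
have [finB|infB] := pselect (finite_set B); last first.
  rewrite [in leRHS](cardinality_infinite infB) addey ?leey//.
  by rewrite gt_eqF// (lt_le_trans _ (cardinality_ge0 A)).
rewrite !cardinality_finite ?finite_setU// fset_setU// -EFinD lee_fin -natrD.
by rewrite ler_nat cardfsU leq_subr.
Qed.

Lemma cardinality_bigsetU_le (T I : Type) (s : seq I) (F : I -> set T) :
  cardinality R (\big[setU/set0]_(i <- s) F i) <=
    \sum_(i <- s) cardinality R (F i).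
Proof.
apply: (big_ind2 (fun A x => cardinality R A <= x)) => //.
- by rewrite cardinality0.
- by move=> A x B y Ax By; apply: (le_trans (cardinalityU_le A B)); exact: leeD.
Qed.

(** Positivity of [M] is there for infinite [B]: it makes [M * +oo] equal to
    [+oo], whereas [0 * +oo = 0]. *)
Lemma cardinality_preimage (T U : Type) (f : T -> U) (B : set U) (M : \bar R) :
  0 < M -> (forall y, cardinality R (f @^-1` [set y]) <= M) ->
  cardinality R (f @^-1` B) <= M * cardinality R B.
Proof.
move=> M_gt0 leM; have [finB|infB] := pselect (finite_set B); last first.
  by rewrite (cardinality_infinite infB) gt0_muley// leey.
have -> : f @^-1` B =
    \big[setU/set0]_(y <- fset_set (B : set {classic U})) f @^-1` [set y].
  by rewrite bigsetU_fset_set// -preimage_bigcup bigcup_imset1 image_id.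
apply: (le_trans (cardinality_bigsetU_le _ _)).
rewrite (cardinality_finite finB) muleC mule_natl.
apply: (le_trans (lee_sum _ (fun y _ => leM y))).
by rewrite big_const_seq count_predT iter_addr_0.
Qed.

End Cardinality.

Section MapMultiplicity.
Variable R : realType.

Lemma cardinality_fiber_le (X Y : nonempty_set) (f : X -> Y) (y : Y) :
  cardinality R (f @^-1` [set y]) <= map_multiplicity R f.
Proof. by apply: ereal_sup_ubound; exists y. Qed.

Lemma map_multiplicity_ge1 (X Y : nonempty_set) (f : X -> Y) :
  1 <= map_multiplicity R f.
Proof.
have [x] := carrier_nonempty X.
apply: le_trans (cardinality_fiber_le f (f x)).
by apply: cardinality_ge1; exists x.
Qed.

Lemma map_multiplicity_id (X : nonempty_set) :
  map_multiplicity R (fun x : X => x) = 1.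
Proof.
apply/eqP; rewrite eq_le map_multiplicity_ge1 andbT.
by apply: ge_ereal_sup => _ [y _ <-]; rewrite preimage_id cardinality1.
Qed.

Lemma map_multiplicity_comp (X Y Z : nonempty_set) (f : X -> Y) (g : Y -> Z) :
  map_multiplicity R (g \o f) <= map_multiplicity R f * map_multiplicity R g.
Proof.
have m_gt0 : 0 < map_multiplicity R f.
  by apply: lt_le_trans (map_multiplicity_ge1 f).
apply: ge_ereal_sup => _ [z _ <-]; rewrite comp_preimage.
apply: (le_trans (cardinality_preimage _ m_gt0 (cardinality_fiber_le f))).
by apply: lee_wpmul2l; [exact: ltW|exact: cardinality_fiber_le].
Qed.

End MapMultiplicity.

Theorem proposition1p4 (R : realType) :
  @is_multiplicity R nonempty_sets (fun X Y f => map_multiplicity R f) /\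
  (forall X : nonempty_set, map_multiplicity R (fun x : X => x) = 1) /\
  (forall (X Y Z : nonempty_set) (f : X -> Y) (g : Y -> Z),
     map_multiplicity R (g \o f) <=
       map_multiplicity R f * map_multiplicity R g).
Proof.
split; last by split; [exact: map_multiplicity_id|exact: map_multiplicity_comp].
split.
- exact: map_multiplicity_ge1.
- exact: map_multiplicity_id.
- exact: map_multiplicity_comp.
Qed.
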